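(* Let $(X,d)$ be a metric space with uniform subexponential growth, that is, \[\lim_{n\to\infty} \frac 1 n \log \sup_{x \in X} |B(x,n)| =0.\] Then the wobbling group $W(X)$ does not contain an infinite countable property $(T)$ group as a subgroup.
   Context: $B(x,n)=\{y\in X: d(x,y)\le n\}$. The wobbling group $W(X)$ of a metric space $(X,d)$ is the group (under composition) of all bijections $g:X\to X$ with $\sup_{x\in X} d(x,g(x))<\infty$. Property $(T)$ is Kazhdan's property $(T)$ for discrete groups. *)

(* Defs.v *)
From HB Require Import structures.
From mathcomp Require Import all_boot all_order all_algebra.
From mathcomp Require Import sesquilinear.
From mathcomp Require Import all_classical all_reals all_analysis.
From mathcomp Require Import complex.

Set Implicit Arguments.
Unset Strict Implicit.
Unset Printing Implicit Defensive.

Import Order.TTheory GRing.Theory Num.Theory.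
Import numFieldNormedType.Exports.

Local Open Scope classical_set_scope.
Local Open Scope ring_scope.

(* The library's [closed_ball] is the closure of an open ball, which in a
   general metric space may be strictly smaller than this set. *)
Definition cball (R : realType) (X : metricType R) (x : X) (r : R) : set X :=
  [set y | mdist x y <= r].

(* Cardinality, supremum and logarithm are taken in the extended reals, so that
   infinite balls count for +oo. *)
Definition uniform_subexponential_growth (R : realType) (X : metricType R) :
    Prop :=
  ((n%:R^-1)%:E *
     lne (ereal_sup [set (counting (cball x n%:R) : \bar R) | x in [set: X]]))%E
    @[n --> \oo] --> 0%E.

Record wobbling (R : realType) (X : metricType R) := Wobbling {
  wobbling_fun :> X -> X;
  wobbling_bij : bijective wobbling_fun;
  wobbling_bounded : has_ubound [set mdist x (wobbling_fun x) | x in [set: X]]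
}.

Section WobblingGroup.
Variables (R : realType) (X : metricType R).
Implicit Types g h k : wobbling X.

Lemma wobbling_inj g h : wobbling_fun g =1 wobbling_fun h -> g = h.
Proof.
case: g h => [g gb gu] [h hb hu] /= /funext gh; rewrite gh in gb gu *.
by congr Wobbling; apply: Prop_irrelevance.
Qed.

HB.instance Definition _ := gen_eqMixin (wobbling X).
HB.instance Definition _ := gen_choiceMixin (wobbling X).

Lemma wobbling_one_bounded : has_ubound [set mdist x (idfun x) | x in [set: X]].
Proof. by exists 0 => _ [x _ <-]; rewrite mdistxx. Qed.

Definition wobbling_one : wobbling X :=
  Wobbling (inv_bij (fun=> erefl)) wobbling_one_bounded.

Lemma wobbling_mul_bounded g h :
  has_ubound [set mdist x ((g \o h) x) | x in [set: X]].
Proof.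
have [[a ga] [b hb]] := (wobbling_bounded g, wobbling_bounded h).
exists (b + a) => _ [x _ <-] /=.
apply: (le_trans (metric_triangle _ (h x) _)).
by apply: lerD; [apply: hb; exists x | apply: ga; exists (h x)].
Qed.

Definition wobbling_mul g h : wobbling X :=
  Wobbling (bij_comp (wobbling_bij g) (wobbling_bij h))
    (wobbling_mul_bounded g h).

Lemma wobbling_inv_subproof g :
  exists h, cancel g (wobbling_fun h) /\ cancel (wobbling_fun h) g.
Proof.
have [f gK fK] := wobbling_bij g; have [a ga] := wobbling_bounded g.
have fu : has_ubound [set mdist x (f x) | x in [set: X]].
  exists a => _ [x _ <-]; rewrite metric_sym -{2}(fK x).
  by apply: ga; exists (f x).
by exists (Wobbling (Bijective fK gK) fu).
Qed.

Definition wobbling_inv g : wobbling X := projT1 (cid (wobbling_inv_subproof g)).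

Lemma wobbling_mulA : associative wobbling_mul.
Proof. by move=> g h k; apply: wobbling_inj. Qed.

Lemma wobbling_mul1g : left_id wobbling_one wobbling_mul.
Proof. by move=> g; apply: wobbling_inj. Qed.

Lemma wobbling_mulg1 : right_id wobbling_one wobbling_mul.
Proof. by move=> g; apply: wobbling_inj. Qed.

Lemma wobbling_mulVg : left_inverse wobbling_one wobbling_inv wobbling_mul.
Proof.
move=> g; apply: wobbling_inj => x /=; rewrite /wobbling_inv.
by case: cid => h [/= gK _]; apply: gK.
Qed.

Lemma wobbling_mulgV : right_inverse wobbling_one wobbling_inv wobbling_mul.
Proof.
move=> g; apply: wobbling_inj => x /=; rewrite /wobbling_inv.
by case: cid => h [/= _ hK]; apply: hK.
Qed.

HB.instance Definition _ := isGroup.Build (wobbling X)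
  wobbling_mulA wobbling_mul1g wobbling_mulg1 wobbling_mulVg wobbling_mulgV.

End WobblingGroup.

(* The norm of a normed module over [R[i]] has its values in [R[i]]. *)
Record hilbert (R : realType) := Hilbert {
  hilbert_sort :> completeNormedModType R[i];
  hilbert_dot : {dot hilbert_sort for Num.conj};
  hilbert_normE : forall x : hilbert_sort, hilbert_dot x x = `|x| ^+ 2
}.

(* Each [pi g] is onto, hence unitary, because [pi 1] is the identity. *)
Definition unitary_representation (R : realType) (G : groupType)
    (H : hilbert R) (pi : G -> {linear H -> H}) : Prop :=
  [/\ forall x, pi 1%g x = x,
      forall g h x, pi (g * h)%g x = pi g (pi h x)
    & forall g x y, hilbert_dot H (pi g x) (pi g y) = hilbert_dot H x y].

Definition has_almost_invariant_vector (R : realType) (G : groupType)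
    (H : hilbert R) (pi : G -> {linear H -> H}) (Q : set G) (eps : R) : Prop :=
  exists2 x : H, x != 0 & forall g, Q g -> `|pi g x - x| < (eps%:C)%C * `|x|.

Definition has_invariant_vector (R : realType) (G : groupType)
    (H : hilbert R) (pi : G -> {linear H -> H}) : Prop :=
  exists2 x : H, x != 0 & forall g, pi g x = x.

(* Compact subsets of a discrete group are its finite subsets. *)
Definition property_T (R : realType) (G : groupType) : Prop :=
  exists (Q : set G) (eps : R),
    [/\ finite_set Q, 0 < eps &
        forall (H : hilbert R) (pi : G -> {linear H -> H}),
          unitary_representation pi ->
          has_almost_invariant_vector pi Q eps -> has_invariant_vector pi].

(* Main.v *)
From HB Require Import structures.
Require Import Defs.
From mathcomp Require Import all_boot all_order all_algebra finmap.
From mathcomp Require Import sesquilinear.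
From mathcomp Require Import all_classical all_reals all_analysis.
From mathcomp Require Import complex summability ring lra.

Set Implicit Arguments.
Unset Strict Implicit.
Unset Printing Implicit Defensive.

Import Order.TTheory GRing.Theory Num.Theory.
Import numFieldNormedType.Exports.

Local Open Scope classical_set_scope.
Local Open Scope ring_scope.
Local Existing Instance totally_filter.

(** Property (T) of [G] forces expansion in the orbits of every action of [G],
    while slow growth of [X] forbids it in the large orbits of a group of
    wobbling maps.

    Expansion. Let [G] act by translations on the functions of [l^2(Y)] whose
    sum over every finite invariant set vanishes. A nonzero invariant vector
    would be constant and nonzero on some orbit; square summability makes that
    orbit finite, and then the sum over it cannot vanish.
    So there is no invariant vector, and property (T) gives one Kazhdan pair
    [(Q, eps)] that works for all actions simultaneously [property_T_gap].
    Testing it on the indicator of a finite subset [A] of an orbit, centred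
    when the orbit is finite, yields Cheeger's inequality
    [property_T_expansion]: if [A] fills at most half of its orbit, some [q]
    in [Q] moves at least the fraction [eps^2/8] of [A] outside [A].

    Growth. If [G] acts on [X] by wobbling maps, the finitely many elements of
    [Q] have displacement at most some [C], so the [Q]-word ball of radius [n]
    lies in the metric ball of radius [C n]. By uniform subexponential growth
    the word balls cannot grow by the factor [1 + d] at each of the first [n]
    steps, for an [n] independent of the centre. Hence every point has a word
    ball of uniformly bounded size, of which each [q] in [Q] moves at most the
    fraction [d] outside [bounded_foelner]. Together with expansion, all orbits have size at most
    some [N].

    Conclusion. Since the action is faithful, an element of the submonoid
    generated by [Q] is determined by what it does on the finitely many
    isomorphism types of [Q]-labelled rooted orbits of size at most [N]; so
    this submonoid [H] is finite [finite_generated]. It satisfies [q H] inside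
    [H] for [q] in [Q], so expansion for the action of [G] on itself by left
    multiplication forces [eps^2 <= 0] unless [G] is finite
    [property_T_unbounded_orbits]. *)

(** * Unconditional sums of complex families *)

Section UnconditionalSums.
Variables (R : realType) (Y : choiceType).
Local Notation C := R[i].

Definition sums_to (F : Y -> C) (l : C) :=
  ((fun A : {fset Y} => \sum_(y <- A) F y : C^o) @ totally --> (l : C^o)).

Lemma sums_to_unique F l l' : sums_to F l -> sums_to F l' -> l = l'.
Proof.
by move=> Fl Fl'; exact: (cvg_unique (@norm_hausdorff _ C^o) Fl Fl').
Qed.

Lemma sums_toD F G l m :
  sums_to F l -> sums_to G m -> sums_to (fun y => F y + G y) (l + m).
Proof.
move=> Fl Gm; rewrite /sums_to.
under eq_fun do rewrite big_split /=.
exact: cvgD Fl Gm.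
Qed.

Lemma sums_toZ (a : C) F l : sums_to F l -> sums_to (fun y => a * F y) (a * l).
Proof.
move=> Fl; rewrite /sums_to.
under eq_fun do rewrite -mulr_sumr /=.
exact: (@cvgM _ _ _ _ (cst (a : C^o))) (cvg_cst _) Fl.
Qed.

Lemma sums_to_conj F l : sums_to F l -> sums_to (fun y => (F y)^* ) l^*.
Proof.
move=> /cvgrPdist_le Fl; apply/cvgrPdist_le => e e0.
apply: filterS (Fl e e0) => A /=.
by rewrite -rmorph_sum -rmorphB norm_conjC.
Qed.

Lemma sums_to_reindex (p q : Y -> Y) F l : cancel p q -> cancel q p ->
  sums_to F l -> sums_to (F \o p) l.
Proof.
move=> pK qK Fl P /Fl [A0 _ PA].
exists [fset q y | y in A0]%fset => // A /= qA.
have -> : \sum_(y <- A) F (p y) = \sum_(y <- [fset p y | y in A]%fset) F y.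
  by rewrite big_imfset //= => x y _ _ /(can_inj pK).
apply: PA; apply/fsubsetP => y yA /=.
apply/imfsetP; exists (q y) => //=.
by apply: (fsubsetP qA); apply/imfsetP; exists y.
Qed.

(** Nonnegative complex numbers are real, so the sum exists as a supremum in
    [R]; it is characterised here by the order of [R[i]], in which suprema do
    not exist in general. *)
Lemma bounded_sums_to (F : Y -> C) (M : C) : (forall y, 0 <= F y) ->
  (forall A : {fset Y}, \sum_(y <- A) F y <= M) ->
  exists l, [/\ sums_to F l, forall A : {fset Y}, \sum_(y <- A) F y <= l
    & forall M' : C, (forall A : {fset Y}, \sum_(y <- A) F y <= M') -> l <= M'].
Proof.
move=> F0 FM.
have FR y : F y = (complex.Re (F y))%:C%C.
  by rewrite RRe_real // realE F0.
pose f y := complex.Re (F y).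
have sumE (A : {fset Y}) : \sum_(y <- A) F y = (\sum_(y <- A) f y)%:C%C.
  by rewrite rmorph_sum /=; apply: eq_bigr => y _; rewrite -FR.
pose S := [set \sum_(y <- A) f y | A in [set: {fset Y}]].
have ubS M' : (forall A : {fset Y}, \sum_(y <- A) F y <= M') ->
    ubound S (complex.Re M').
  by move=> FM' _ [A _ <-]; move: (FM' A); rewrite sumE lecE => /andP[].
have supS : has_sup S.
  split; first by exists (\sum_(y <- fset0) f y); exists fset0.
  by exists (complex.Re M); exact: ubS.
have le_sup (A : {fset Y}) : \sum_(y <- A) f y <= sup S.
  by apply: (sup_upper_bound supS); exists A.
exists (sup S)%:C%C; split.
- apply/cvgrPdist_le => e e0.
  have eE : e = (complex.Re e)%:C%C by rewrite RRe_real // realE ltW.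
  have e0' : 0 < complex.Re e by move: e0; rewrite {1}eE ltcR.
  have [_ [A0 _ <-] ltA0] := sup_adherent e0' supS.
  exists A0 => // A /= A0A.
  rewrite sumE eE -rmorphB /= normc_def /= expr0n /= addr0 sqrtr_sqr lecR.
  rewrite ger0_norm ?subr_ge0 // lerBlDl -lerBlDr.
  apply: (le_trans (ltW ltA0)).
  have f0 y : 0 <= f y by rewrite -lecR -FR.
  rewrite [leRHS](big_fsetID _ (mem A0)) /=.
  rewrite (_ : [fset _ | _ in _ & _]%fset = A0).
    by rewrite lerDl sumr_ge0.
  by apply/fsetP => y; rewrite !inE /= andb_idl //; apply: (fsubsetP A0A).
- by move=> A; rewrite sumE lecR.
- move=> M' FM'; have M'R : M' = (complex.Re M')%:C%C.
    rewrite RRe_real // realE (le_trans _ (FM' fset0)) //.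
    by rewrite big_seq_fset0.
  by rewrite M'R lecR; apply: sup_le_ub supS.1 (ubS _ FM').
Qed.

End UnconditionalSums.

Arguments sums_toZ {R Y} a {F l}.
(** * Limits in the complex numbers *)

Section ComplexTopology.
Variable R : realType.
Local Notation C := R[i].

Lemma normC_Re_le (z : C) : (`|complex.Re z|)%:C%C <= `|z|.
Proof. by rewrite normc_def lecR -sqrtr_sqr ler_wsqrtr // lerDl sqr_ge0. Qed.

Lemma normC_Im_le (z : C) : (`|complex.Im z|)%:C%C <= `|z|.
Proof. by rewrite normc_def lecR -sqrtr_sqr ler_wsqrtr // lerDr sqr_ge0. Qed.

Lemma normC_le_ReIm (z : C) :
  `|z| <= (`|complex.Re z| + `|complex.Im z|)%:C%C.
Proof.
rewrite {1}[z]complexE (le_trans (ler_normD _ _)) // normrM.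
have normR (x : R) : `|x%:C%C| = (`|x|)%:C%C :> C.
  by rewrite normc_def /= expr0n /= addr0 sqrtr_sqr.
by rewrite !normR normc_def /= expr0n expr1n add0r sqrtr1 mul1r rmorphD.
Qed.

Lemma complex_complete (F : set_system C^o) :
  ProperFilter F -> cauchy F -> cvg F.
Proof.
move=> FF /cauchy_ballP Fc.
have part (p : C -> R) : {morph p : x y / x - y} ->
    (forall z, (`|p z|)%:C%C <= `|z|) -> exists a : R, p @ F --> a.
  move=> pB p_le; apply/cvg_ex; apply: R_complete; apply/cauchy_exP => e e0.
  have /(cauchyP F)/(_ e%:C%C) [] : cauchy F by apply/cauchy_ballP.
    by rewrite ltcR.
  move=> z Fz; exists (p z); rewrite -ball_normE.
  move: Fz; rewrite -ball_normE /= => Fz; apply: (@filterS _ F) Fz => w /= zw.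
  by rewrite -ltcR; apply: le_lt_trans zw; rewrite -[_ - _](pB z w).
have [a Fa] := part (@complex.Re R)
  (raddfB (@complex.Re R : Rcomplex R -> R)) normC_Re_le.
have [b Fb] := part (@complex.Im R)
  (raddfB (@complex.Im R : Rcomplex R -> R)) normC_Im_le.
apply/cvg_ex; exists (a +i* b)%C.
apply/cvgrPdist_le => e e0.
have eE : e = (complex.Re e)%:C%C by rewrite RRe_real // realE ltW.
have e0' : 0 < complex.Re e / 2.
  by rewrite divr_gt0 //; move: e0; rewrite {1}eE ltcR.
move/cvgrPdist_le : Fa => /(_ _ e0') Fa.
move/cvgrPdist_le : Fb => /(_ _ e0') Fb.
apply: filterS2 Fa Fb => z /= Fa Fb.
rewrite (le_trans (normC_le_ReIm _)) // eE lecR [leRHS]splitr.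
by case: z Fa Fb => x y /= Fa Fb; rewrite lerD.
Qed.

(** The order of [R[i]] is partial, so closedness of the half lines does not
    come from an order topology: eventually [M - u] equals its norm, and
    norms pass to the limit. *)
Lemma cvg_complex_le T (F : set_system T) (FF : ProperFilter F) (u : T -> C^o)
    (l M : C) : u @ F --> (l : C^o) -> (\forall x \near F, u x <= M) -> l <= M.
Proof.
move=> ul uM.
have vl : (M : C^o) - u x @[x --> F] --> (M - l : C^o).
  by apply: cvgB ul; exact: cvg_cst.
have nl := cvg_norm vl _.
have vl' : `|(M : C^o) - u x| @[x --> F] --> (M - l : C^o).
  apply: cvg_trans vl; apply: near_eq_cvg.
  by apply: filterS uM => x ux; rewrite ger0_norm // subr_ge0.
rewrite -subr_ge0 -(cvg_unique (@norm_hausdorff _ C^o) (nl _) vl').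
exact: normr_ge0.
Qed.

End ComplexTopology.

(** * The norm of an inner product *)

Section InnerProductNorm.
Variables (C : numClosedFieldType) (U : lmodType C).
Variable (form : {dot U for Num.conj}).
Local Notation "''[' u , v ]" := (form u%R v%R) : ring_scope.
Local Notation "''[' u ]" := '[u, u]%R : ring_scope.

(** The squared norm of the component of [u] orthogonal to [v] is
    nonnegative. *)
Lemma dot_CauchySchwarz u v : `|'[u, v]| ^+ 2 <= '[u] * '[v].
Proof.
have [->|v0] := eqVneq v 0.
  by rewrite linear0r normr0 expr0n mulr_ge0 // dnorm_ge0.
have vv0 : '[v] > 0 by rewrite dnorm_gt0.
pose a := '[u, v] / '[v].
have vvJ : '[v]^* = '[v] by apply/CrealP; rewrite realE ltW.
have := dnorm_ge0 form (u - a *: v).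
rewrite dnormB dnormZ linearZr_LR /=.
have -> : a^* * '[u, v] = `|'[u, v]| ^+ 2 / '[v].
  rewrite /a rmorphM /= fmorphV /= vvJ normCK mulrAC.
  by congr (_ / _); rewrite mulrC.
have -> : `|a| ^+ 2 * '[v] = `|'[u, v]| ^+ 2 / '[v].
  rewrite /a normrM normfV (gtr0_norm vv0) exprMn exprVn -mulrA; congr (_ * _).
  by rewrite expr2 invfM -mulrA mulVf ?mulr1 // gt_eqF.
rewrite rmorphM rmorphXn /= fmorphV /= vvJ conj_normC.
by rewrite opprD addrA addrK subr_ge0 ler_pdivrMr.
Qed.

Lemma sqrt_dnormD u v : sqrtC '[u + v] <= sqrtC '[u] + sqrtC '[v].
Proof.
rewrite -ler_sqr ?nnegrE ?addr_ge0 ?sqrtC_ge0 ?dnorm_ge0 //.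
rewrite sqrrD !sqrtCK dnormD [leRHS]addrAC lerD2l.
rewrite -[leLHS](@divfK _ 2) ?pnatr_eq0 // -[leRHS]mulr_natr ler_pM2r ?ltr0n //.
rewrite -ReE (le_trans (leif_Re_Creal _)) //.
rewrite -ler_sqr ?nnegrE ?mulr_ge0 ?sqrtC_ge0 ?dnorm_ge0 //.
by rewrite exprMn !sqrtCK dot_CauchySchwarz.
Qed.

Lemma sqrt_dnormZ a u : sqrtC '[a *: u] = `|a| * sqrtC '[u].
Proof. by rewrite dnormZ sqrtCM ?nnegrE ?dnorm_ge0 ?exprn_ge0 // sqrCK. Qed.

End InnerProductNorm.
(** * The Hilbert space of square summable functions with vanishing sums *)

Lemma polarization (C : numClosedFieldType) (a b : C) :
  let sq c := (a + c * b) * (a + c * b)^* in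
  4^-1 * ((sq 1 + -1 * sq (-1)) + ('i * sq 'i + - 'i * sq (- 'i))) = a * b^*.
Proof.
have i2 : 'i * 'i = -1 :> C by rewrite -expr2 sqrCi.
rewrite /= !rmorphD !rmorphM !rmorphN rmorph1 /= conjCi.
by field: i2.
Qed.

Section SquareSummable.
Variables (R : realType) (Y : choiceType).
Local Notation C := R[i].
Implicit Types f g : Y -> C.

Definition sq_summable f :=
  exists M : C, forall A : {fset Y}, \sum_(y <- A) `|f y| ^+ 2 <= M.

Lemma sq_summableD f g :
  sq_summable f -> sq_summable g -> sq_summable (f + g).
Proof.
move=> [M fM] [N gN]; exists (2 * M + 2 * N) => A.
apply: (@le_trans _ _ (\sum_(y <- A) (2 * `|f y| ^+ 2 + 2 * `|g y| ^+ 2))).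
  apply: ler_sum => y _.
  apply: (@le_trans _ _ ((`|f y| + `|g y|) ^+ 2)).
    by rewrite ler_sqr ?nnegrE ?addr_ge0 // ler_normD.
  rewrite -subr_ge0 (_ : _ - _ = (`|f y| - `|g y|) ^+ 2); last by ring.
  by rewrite -realEsqr realB // normr_real.
by rewrite big_split /= -!mulr_sumr lerD // ler_wpM2l.
Qed.

Lemma sq_summableZ (a : C) f : sq_summable f -> sq_summable (a *: f).
Proof.
move=> [M fM]; exists (`|a| ^+ 2 * M) => A.
rewrite (eq_bigr (fun y => `|a| ^+ 2 * `|f y| ^+ 2)).
  by rewrite -mulr_sumr ler_wpM2l // exprn_ge0.
by move=> y _; rewrite normrM exprMn.
Qed.

Lemma sums_to_sqr f : sq_summable f -> exists l : C,
  [/\ sums_to (fun y => f y * (f y)^* ) l,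
      forall A : {fset Y}, \sum_(y <- A) `|f y| ^+ 2 <= l
    & forall M : C, (forall A : {fset Y}, \sum_(y <- A) `|f y| ^+ 2 <= M) ->
        l <= M].
Proof.
move=> [M fM]; have [|l [fl ubl lubl]] := bounded_sums_to _ fM.
  by move=> y; rewrite exprn_ge0.
by exists l; split => //; under eq_fun do rewrite -normCK.
Qed.

(** The polarization identity reduces the convergence of inner products to
    that of bounded sums of squares. *)
Lemma sums_to_mul_conj f g : sq_summable f -> sq_summable g ->
  exists l, sums_to (fun y => f y * (g y)^* ) l.
Proof.
move=> sf sg.
have pol (a : C) : exists l, sums_to
    (fun y => (f + a *: g) y * ((f + a *: g) y)^* ) l.
  have [l [fl _ _]] := sums_to_sqr (sq_summableD sf (sq_summableZ a sg)).
  by exists l.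
have [l1 L1] := pol 1; have [l2 L2] := pol (-1).
have [l3 L3] := pol 'i; have [l4 L4] := pol (- 'i).
have := sums_toZ 4^-1 (sums_toD (sums_toD L1 (sums_toZ (-1) L2))
  (sums_toD (sums_toZ 'i L3) (sums_toZ (- 'i) L4))).
set l := 4^-1 * _ => Ll; exists l; congr (sums_to _ l): Ll.
by apply/funext => y; exact: polarization.
Qed.

End SquareSummable.
Section Ell2.
Variables (R : realType) (Y : choiceType) (L : set {fset Y}).
Local Notation C := R[i].

(** Each constraint, orthogonality to the indicator of a finite set in [L],
    involves finitely many values. It therefore survives pointwise limits,
    which keeps the space complete. *)
Definition ell2_pred : {pred Y -> C} := fun f =>
  `[< sq_summable f /\ forall s : {fset Y}, L s -> \sum_(y <- s) f y = 0 >].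

Lemma ell2_predP f : reflect
  (sq_summable f /\ forall s : {fset Y}, L s -> \sum_(y <- s) f y = 0)
  (f \in ell2_pred).
Proof. exact: asboolP. Qed.

Lemma ell2_submod_closed : submod_closed ell2_pred.
Proof.
split.
  apply/ell2_predP; split; last by move=> s _; rewrite big1.
  by exists 0 => A; rewrite big1 // => y _; rewrite normr0 expr0n.
move=> a f g /ell2_predP[sf f0] /ell2_predP[sg g0]; apply/ell2_predP; split.
  exact: sq_summableD (sq_summableZ a sf) sg.
move=> s Ls; transitivity (a * \sum_(y <- s) f y + \sum_(y <- s) g y).
  by rewrite mulr_sumr -big_split.
by rewrite f0 // g0 // mulr0 addr0.
Qed.

HB.instance Definition _ :=
  GRing.isSubmodClosed.Build C (Y -> C) ell2_pred ell2_submod_closed.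

Record ell2 : Type := Ell2 {
  ell2_fun :> Y -> C;
  ell2_funP : ell2_fun \in ell2_pred
}.

HB.instance Definition _ := [isSub for ell2_fun].
HB.instance Definition _ := [Choice of ell2 by <:].
HB.instance Definition _ := [SubChoice_isSubLmodule of ell2 by <:].

Implicit Types f g h : ell2.

Lemma ell2_sq_summable f : sq_summable f.
Proof. by have /ell2_predP[] := ell2_funP f. Qed.

Lemma ell2_sum_eq0 f (s : {fset Y}) : L s -> \sum_(y <- s) f y = 0.
Proof. by have /ell2_predP[_] := ell2_funP f; exact. Qed.

Definition ell2_dot f g : C :=
  xget 0 [set l | sums_to (fun y => f y * (g y)^* ) l].

Lemma ell2_dotP f g l :
  sums_to (fun y => f y * (g y)^* ) l -> ell2_dot f g = l.
Proof.
move=> fg; rewrite /ell2_dot; apply: xget_unique => // l' fg'.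
exact: sums_to_unique fg' fg.
Qed.

Lemma sums_to_ell2_dot f g : sums_to (fun y => f y * (g y)^* ) (ell2_dot f g).
Proof.
have [l fg] := sums_to_mul_conj (ell2_sq_summable f) (ell2_sq_summable g).
by rewrite (ell2_dotP fg).
Qed.

Arguments sums_to_ell2_dot f g : clear implicits.

Lemma ell2_dotC f g : ell2_dot f g = (ell2_dot g f)^*.
Proof.
apply: ell2_dotP; have := sums_to_conj (sums_to_ell2_dot g f).
congr sums_to; apply/funext => y.
by rewrite rmorphM /= conjCK mulrC.
Qed.

Lemma ell2_dot_linearl g a f h :
  ell2_dot (a *: f + h) g = a * ell2_dot f g + ell2_dot h g.
Proof.
apply: ell2_dotP.
have := sums_toD (sums_toZ a (sums_to_ell2_dot f g)) (sums_to_ell2_dot h g).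
congr sums_to; apply/funext => y.
by rewrite mulrA -mulrDl.
Qed.

Lemma ell2_dot_bilinear :
  bilinear_for (GRing.Scale.Law.clone _ _ ( *%R ) _)
    (GRing.Scale.Law.clone _ _ (@Num.conj C \; *%R ) _) ell2_dot.
Proof.
split=> [g a f h|f a g h] /=; first exact: ell2_dot_linearl.
by rewrite ell2_dotC ell2_dot_linearl rmorphD rmorphM /= -!ell2_dotC.
Qed.

HB.instance Definition _ := bilinear_isBilinear.Build C ell2 ell2 C _ _ ell2_dot
  ell2_dot_bilinear.

Lemma ell2_dot_hermitian f g :
  ell2_dot f g = (-1) ^+ false * Num.conj (ell2_dot g f).
Proof. by rewrite expr0 mul1r -ell2_dotC. Qed.

HB.instance Definition _ :=
  isHermitianSesquilinear.Build C ell2 false Num.conj ell2_dot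
    ell2_dot_hermitian.

Lemma ell2_dot_ge f (A : {fset Y}) : \sum_(y <- A) `|f y| ^+ 2 <= ell2_dot f f.
Proof.
have [l [fl le_l _]] := sums_to_sqr (ell2_sq_summable f).
by rewrite (ell2_dotP fl).
Qed.

Lemma ell2_dot_le f (M : C) :
  (forall A : {fset Y}, \sum_(y <- A) `|f y| ^+ 2 <= M) -> ell2_dot f f <= M.
Proof.
have [l [fl _ l_le]] := sums_to_sqr (ell2_sq_summable f).
by rewrite (ell2_dotP fl); exact: l_le.
Qed.

Lemma ell2_dot_gt0 f : f != 0 -> 0 < ell2_dot f f.
Proof.
move=> f0.
have [y fy] : exists y, f y != 0.
  apply: contrapT => fy; move/eqP : f0; apply.
  apply: val_inj; apply/funext => y; apply/eqP; apply: contrapT => /negP fy0.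
  by apply: fy; exists y.
apply: (lt_le_trans _ (ell2_dot_ge f [fset y]%fset)).
by rewrite big_seq_fset1 exprn_gt0 // normr_gt0.
Qed.

HB.instance Definition _ := isDotProduct.Build C ell2 ell2_dot ell2_dot_gt0.

Definition ell2_norm f : C := sqrtC (ell2_dot f f).

Lemma ell2_norm_eq0 f : ell2_norm f = 0 -> f = 0.
Proof.
move=> /eqP; rewrite sqrtC_eq0 => f0; apply/eqP; apply: contraLR f0.
by move=> /ell2_dot_gt0; rewrite lt0r => /andP[].
Qed.

HB.instance Definition _ := Lmodule_isNormed.Build C ell2
  (sqrt_dnormD ell2_dot) (sqrt_dnormZ ell2_dot) ell2_norm_eq0.

End Ell2.
Lemma sqr_dist_continuous (K : numFieldType) (a : K) :
  continuous (fun z : K^o => `|a - z| ^+ 2 : K^o).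
Proof.
move=> z; have FF : Filter (nbhs (z : K^o)) by exact: nbhs_filter.
have sz : a - w @[w --> (z : K^o)] --> (a - z : K^o).
  apply: (@cvgB _ K^o _ _ FF (cst (a : K^o)) id a z); first exact: cvg_cst.
  exact: cvg_id.
have nz : `|a - w| @[w --> (z : K^o)] --> (`|a - z| : K^o)
  by exact: cvg_norm sz.
rewrite /continuous_at expr2; under eq_fun do rewrite expr2.
exact: (cvgM nz nz).
Qed.

Section Ell2Hilbert.
Variables (R : realType) (Y : choiceType) (L : set {fset Y}).
Local Notation C := R[i].
Local Notation H := (ell2 R L).
Implicit Types f g h : H.

Lemma ell2_norm_sqr f : ell2_dot f f = `|f| ^+ 2.
Proof. by rewrite [RHS]sqrtCK. Qed.

Lemma ell2_partial_sum_le f (A : {fset Y}) :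
  \sum_(y <- A) `|f y| ^+ 2 <= `|f| ^+ 2.
Proof. by rewrite -ell2_norm_sqr ell2_dot_ge. Qed.

Lemma ell2_norm_le f (e : C) : 0 <= e ->
  (forall A : {fset Y}, \sum_(y <- A) `|f y| ^+ 2 <= e ^+ 2) -> `|f| <= e.
Proof.
by move=> e0 fe; rewrite -ler_sqr ?nnegrE // -ell2_norm_sqr ell2_dot_le.
Qed.

Lemma ell2_eval_le f y : `|f y| <= `|f|.
Proof.
rewrite -ler_sqr ?nnegrE //.
by have := ell2_partial_sum_le f [fset y]%fset; rewrite big_seq_fset1.
Qed.

(** A Cauchy filter converges pointwise to some [l]. The bound on the distance
    from [f] to the elements of the filter holds for every finite partial sum,
    hence for [l], which shows both that [l] is square summable and that the
    filter converges to it in norm. *)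
Lemma ell2_complete (F : set_system H) : ProperFilter F -> cauchy F -> cvg F.
Proof.
move=> FF Fc.
have /choice [l Fl] : forall y, exists l : C^o,
    (fun f : H => f y : C^o) @ F --> l.
  move=> y; apply/cvg_ex; apply: complex_complete; apply/cauchy_exP => e e0.
  have [f Ff] := (cauchyP F).1 Fc e e0.
  exists (f y); rewrite -ball_normE /=.
  move: Ff; rewrite -ball_normE /=; apply: filterS => g /= fg.
  exact: le_lt_trans (ell2_eval_le (f - g) y) fg.
have sums_l (A : {fset Y}) (G : C -> Y -> C)
    (Gc : forall y, continuous (G ^~ y : C^o -> C^o)) :
    (fun f : H => \sum_(y <- A) G (f y) y : C^o) @ F -->
    (\sum_(y <- A) G (l y) y : C^o).
  apply: cvg_big => [|y _]; first exact: add_continuous.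
  exact: continuous_cvg (Gc y _) (Fl y).
have dist_l f (e : C) : 0 < e -> F [set g | `|f - g| < e] ->
    forall A : {fset Y}, \sum_(y <- A) `|f y - l y| ^+ 2 <= e ^+ 2.
  move=> e0 Ff A.
  apply: (cvg_complex_le FF (sums_l A (fun z y => `|f y - z| ^+ 2) _)).
    by move=> y; exact: sqr_dist_continuous.
  apply: filterS Ff => g /= fg.
  apply: (le_trans (ell2_partial_sum_le (f - g) A)).
  by rewrite ler_sqr ?nnegrE // ltW.
have [f1 Ff1] := (cauchyP F).1 Fc 1 ltr01.
have lP : l \in @ell2_pred R Y L.
  apply/ell2_predP; split.
    have -> : l = ell2_fun f1 + (-1) *: (ell2_fun f1 - l).
      by rewrite scaleN1r opprB addrC subrK.
    apply: sq_summableD; first exact: ell2_sq_summable.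
    apply: sq_summableZ; exists (1 ^+ 2).
    exact: dist_l Ff1.
  move=> s Ls.
  have := sums_l s (fun z _ => z) (fun _ _ => cvg_id).
  have -> : (fun f : H => \sum_(y <- s) f y : C^o) = cst 0.
    by apply/funext => f; rewrite ell2_sum_eq0.
  by move=> /(cvg_unique (@norm_hausdorff _ C^o)) /(_ (cvg_cst _)).
apply/cvg_ex; exists (Ell2 lP); apply/cvgrPdist_le => e e0.
have e20 : 0 < e / 2 by rewrite divr_gt0.
have [f Ff] := (cauchyP F).1 Fc _ e20.
move: Ff; rewrite -ball_normE /= => Ff; apply: filterS (Ff) => g /= fg.
rewrite [e]splitr -(subrK f (Ell2 lP)) -addrA (le_trans (ler_normD _ _)) //.
rewrite lerD ?(ltW fg) // distrC; apply: ell2_norm_le; first exact: ltW.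
exact: dist_l.
Qed.

HB.instance Definition _ := Uniform_isComplete.Build H ell2_complete.

Definition ell2_hilbert : hilbert R :=
  @Hilbert R H (@ell2_dot R Y L) ell2_norm_sqr.

End Ell2Hilbert.
(** * The spectral gap of the permutation representations *)

Lemma sum_fset_inj (V : nmodType) (Y : choiceType) (p : Y -> Y) (F : Y -> V)
    (A : {fset Y}) : injective p ->
  \sum_(y <- A) F (p y) = \sum_(y <- [fset p y | y in A]%fset) F y.
Proof. by move=> pI; rewrite big_imfset //= => x y _ _ /pI. Qed.

Section KoopmanRepresentation.
Variables (R : realType) (G : groupType) (Y : choiceType) (act : G -> Y -> Y).
Hypothesis act1 : forall y, act 1%g y = y.
Hypothesis actM : forall g h y, act (g * h)%g y = act g (act h y).
Local Notation C := R[i].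

Lemma actK g : cancel (act g) (act g^-1).
Proof. by move=> y; rewrite -actM mulVg act1. Qed.

Lemma actVK g : cancel (act g^-1) (act g).
Proof. by move=> y; rewrite -actM mulgV act1. Qed.

Definition invariant_fset (s : {fset Y}) :=
  forall g y, y \in s -> act g y \in s.

Local Notation H := (ell2 R invariant_fset).
Implicit Types f h : H.

Lemma translate_subproof g f :
  (fun y => f (act g^-1 y)) \in @ell2_pred R Y invariant_fset.
Proof.
have gI : injective (act g^-1) := can_inj (actVK g).
apply/ell2_predP; split.
  have [M fM] := ell2_sq_summable f; exists M => A.
  by rewrite (sum_fset_inj (fun y => `|f y| ^+ 2)).
move=> s sG; rewrite (sum_fset_inj f) // (_ : [fset _ | _ in _]%fset = s).
  exact: ell2_sum_eq0.
apply/fsetP => y; apply/imfsetP/idP => [[x /= xs ->]|ys]; first exact: sG.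
by exists (act g y); rewrite ?actK //; exact: sG.
Qed.

Definition translate g f : H := Ell2 (translate_subproof g f).

Lemma translate_linear g : linear (translate g).
Proof. by move=> a f h; apply: val_inj. Qed.

HB.instance Definition _ g :=
  GRing.isLinear.Build C H H *:%R (translate g) (translate_linear g).

Definition koopman (g : G) :
    {linear ell2_hilbert R invariant_fset -> ell2_hilbert R invariant_fset} :=
  translate g.

Lemma koopman_unitary : unitary_representation koopman.
Proof.
split=> [f|g h f|g f h].
- by apply: val_inj; apply/funext => y /=; rewrite invg1 act1.
- by apply: val_inj; apply/funext => y /=; rewrite invgM actM.
- apply: ell2_dotP.
  have := sums_to_reindex (actVK g) (actK g) (@sums_to_ell2_dot R Y _ f h).
  exact.
Qed.

(** An invariant [f] is constant on the orbit [O] of a point [y] where it does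
    not vanish. If [O] were infinite the sums of squares would be unbounded; if
    it is finite, the sum of [f] over it is [#|O| * f y], and it is zero. *)
Lemma koopman_no_invariant_vector : ~ has_invariant_vector koopman.
Proof.
move=> [f f0 finv]; move/eqP : f0; apply; apply: val_inj; apply/funext => y.
apply: contrapT => /eqP fy.
pose O := [set act g y | g in [set: G]].
have fO z : O z -> f z = f y.
  move=> [g _ <-]; have /(congr1 (fun h : H => h (act g y))) := finv g.
  by rewrite /= actK.
have finO : finite_set O.
  apply: contrapT => infO.
  have [M fM] := ell2_sq_summable f.
  have [n Mn] : exists n : nat, complex.Re (M / `|f y| ^+ 2) < n%:R.
    by exists (Num.truncn (complex.Re (M / `|f y| ^+ 2))).+1; apply: truncnS_gt.
  have [B BO nB] := infinite_set_fset n infO.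
  have := fM B; rewrite (eq_big_seq (fun=> `|f y| ^+ 2)); last first.
    by move=> z zB; rewrite fO //; exact: BO.
  rewrite big_const_seq count_predT iter_addr_0 -mulr_natl.
  rewrite -ler_pdivlMr ?exprn_gt0 ?normr_gt0 //.
  have -> : (size B)%:R = ((size B)%:R : R)%:C%C :> C by rewrite rmorph_nat.
  rewrite lecE /= => /andP[_] /le_lt_trans /(_ Mn).
  by rewrite ltr_nat ltnNge nB.
have sG : invariant_fset (fset_set O).
  move=> g z; rewrite !in_fset_set // !inE => -[h _ <-].
  by exists (g * h)%g => //; rewrite actM.
have := ell2_sum_eq0 f sG.
rewrite (eq_big_seq (fun=> f y)); last first.
  by move=> z; rewrite in_fset_set // inE => /fO.
rewrite big_const_seq count_predT iter_addr_0 => /eqP.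
rewrite mulrn_eq0 (negPf fy) orbF size_eq0 => /eqP s0.
have : y \in fset_set O.
  by rewrite in_fset_set // inE; exists 1%g.
by rewrite -[y \in _]/(y \in enum_fset _) s0.
Qed.

End KoopmanRepresentation.

(** The consequence of property (T) for real functions, freed from Hilbert
    spaces: [m] bounds the squared norm of [f] from below, and [r] bounds the
    squared displacements of [f] by [Q] from above. *)
Lemma property_T_gap (R : realType) (G : groupType) : property_T R G ->
  exists (Q : seq G) (eps : R), 0 < eps /\
    forall (Y : choiceType) (act : G -> Y -> Y),
      (forall y, act 1%g y = y) ->
      (forall g h y, act (g * h)%g y = act g (act h y)) ->
    forall (f : Y -> R) (M m r : R),
      (forall A : {fset Y}, \sum_(y <- A) f y ^+ 2 <= M) ->
      (forall s : {fset Y}, invariant_fset act s -> \sum_(y <- s) f y = 0) ->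
      0 < m -> (exists A : {fset Y}, m <= \sum_(y <- A) f y ^+ 2) ->
      (forall q (A : {fset Y}), q \in Q ->
        \sum_(y <- A) (f (act q^-1%g y) - f y) ^+ 2 <= r) ->
    eps ^+ 2 * m <= r.
Proof.
move=> [Q0 [eps [/finite_seqP[Q QE] eps0 TG]]]; exists Q, eps; split => //.
move=> Y act act1 actM f M m r fM f0 m0 [A0 mA0] fr.
rewrite leNgt; apply/negP => rm.
have sqrC (x : R) : `|x%:C%C| ^+ 2 = (x ^+ 2)%:C%C :> R[i].
  by rewrite -add_Re2_Im2 /= expr0n addr0.
have FP : (fun y => (f y)%:C%C) \in @ell2_pred R Y (invariant_fset act).
  apply/ell2_predP; split.
    exists M%:C%C => A; under eq_bigr do rewrite sqrC.
    by rewrite -rmorph_sum lecR.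
  by move=> s sG; rewrite -rmorph_sum /= f0.
pose F : ell2_hilbert R (invariant_fset act) := Ell2 FP.
have Fm : m%:C%C <= `|F| ^+ 2.
  apply: le_trans (ell2_partial_sum_le (F : ell2 _ _) A0).
  by under eq_bigr do rewrite sqrC; rewrite -rmorph_sum lecR.
have F0 : F != 0.
  by apply/eqP => F0; move: Fm; rewrite F0 normr0 expr0n /= lecR leNgt m0.
have := TG _ _ (koopman_unitary R act1 actM).
suff aiv : has_almost_invariant_vector (koopman R act1 actM) Q0 eps.
  by move=> /(_ aiv); exact: koopman_no_invariant_vector.
exists F => // q; rewrite QE /= => qQ.
rewrite -ltr_sqr ?nnegrE ?mulr_ge0 ?ler0c ?(ltW eps0) //.
rewrite -[ltLHS](ell2_norm_sqr (_ : ell2 _ _)).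
apply: (@le_lt_trans _ _ r%:C%C).
  apply: ell2_dot_le => A.
  have -> : \sum_(y <- A) `|(koopman R act1 actM q F - F : ell2 _ _) y| ^+ 2
      = (\sum_(y <- A) (f (act q^-1%g y) - f y) ^+ 2)%:C%C.
    rewrite rmorph_sum; apply: eq_bigr => y _ /=.
    by rewrite -sqrC rmorphB.
  by rewrite lecR fr.
rewrite exprMn; apply: lt_le_trans (ler_wpM2l _ Fm).
  by rewrite -rmorphXn -rmorphM ltcR.
by rewrite exprn_ge0 // ler0c ltW.
Qed.
(** * Expansion in the orbits *)

Section Expansion.
Variables (R : realType) (Y : choiceType).
Implicit Types A B : {fset Y}.

Lemma sum_mem_fset A B :
  \sum_(y <- B) (y \in A)%:R = #|` B `&` A|%fset%:R :> R.
Proof.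
rewrite -natr_sum; congr (_%:R).
rewrite (big_fsetID _ (mem A)) /= [X in (_ + X)%N]big1_fset ?addn0; last first.
  by move=> y; rewrite !inE /= => /andP[_ /negPf ->].
rewrite (eq_big_seq (fun=> 1%N)); last first.
  by move=> y; rewrite !inE /= => /andP[_ ->].
rewrite big_const_seq count_predT iter_addn_0 mul1n.
by congr (size (enum_fset _)); apply/fsetP => y; rewrite !inE.
Qed.

Lemma sum_mem_fset_le A B : \sum_(y <- B) (y \in A)%:R <= #|` A|%:R :> R.
Proof. by rewrite sum_mem_fset ler_nat fsubset_leq_card // fsubsetIr. Qed.

End Expansion.

Lemma fset_set_infinite (Y : choiceType) (A : set Y) :
  infinite_set A -> fset_set A = fset0.
Proof. by rewrite /fset_set; case: pselect. Qed.

Section OrbitFset.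
Variables (G : groupType) (Y : choiceType) (act : G -> Y -> Y).
Hypothesis act1 : forall y, act 1%g y = y.
Hypothesis actM : forall g h y, act (g * h)%g y = act g (act h y).

(** Empty when the orbit is infinite: then there is nothing to subtract from
    the indicator of a finite set to make it orthogonal to the finite invariant
    sets, and both cases are covered by one formula. *)
Definition orbit_fset (x : Y) : {fset Y} :=
  fset_set [set act g x | g in [set: G]].

Lemma orbit_fset_act g x y : (act g y \in orbit_fset x) = (y \in orbit_fset x).
Proof.
have inv h z : z \in orbit_fset x -> act h z \in orbit_fset x.
  have [fin|inf] := pselect (finite_set [set act g x | g in [set: G]]).
    rewrite !in_fset_set // !inE => -[k _ <-].
    by exists (h * k)%g => //; rewrite actM.
  by rewrite /orbit_fset fset_set_infinite.
apply/idP/idP; last exact: inv.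
by move=> /(inv g^-1%g); rewrite (actK act1 actM).
Qed.

Lemma sub_invariant_fset (s : {fset Y}) x : invariant_fset act s -> x \in s ->
  (forall g, act g x \in orbit_fset x) /\ {subset orbit_fset x <= s}.
Proof.
move=> sG xs.
have fin : finite_set [set act g x | g in [set: G]].
  apply: (@sub_finite_set _ _ [set` s]) => [_ [g _ <-]|]; first exact: sG.
  exact: finite_fset.
split => [g|z]; rewrite in_fset_set // inE; first by exists g.
by move=> [g _ <-]; exact: sG.
Qed.

Lemma orbit_fset_sub x y : y \in orbit_fset x -> exists g, act g x = y.
Proof.
have [fin|inf] := pselect (finite_set [set act g x | g in [set: G]]).
  by rewrite in_fset_set // inE => -[g _ <-]; exists g.
by rewrite /orbit_fset fset_set_infinite.
Qed.

End OrbitFset.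

(** Cheeger's inequality: the spectral gap applied to the indicator of [A]
    minus its mean value on the orbit. Subtracting the constant [c] on the
    orbit does not affect displacements, and as [c] is at most [1/2] it leaves
    at least a quarter of the squared norm of the indicator. *)
Lemma property_T_expansion (R : realType) (G : groupType) : property_T R G ->
  exists (Q : seq G) (eps : R), 0 < eps /\
    forall (Y : choiceType) (act : G -> Y -> Y),
      (forall y, act 1%g y = y) ->
      (forall g h y, act (g * h)%g y = act g (act h y)) ->
    forall (x : Y) (A : {fset Y}) (d : R),
      A != fset0 -> (forall y, y \in A -> exists g, act g x = y) ->
      (forall O : {fset Y}, invariant_fset act O -> x \in O ->
        (2 * #|` A| <= #|` O|)%N) ->
      (forall q, q \in Q ->
        #|` [fset act q y | y in A] `\` A|%fset%:R <= d * #|` A|%:R) ->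
    eps ^+ 2 <= 8 * d.
Proof.
move=> /property_T_gap[Q [eps [eps0 gap]]]; exists Q, eps; split => //.
move=> Y act act1 actM x A d A0 Ax AO Ad.
have nA0 : 0 < #|` A|%:R :> R by rewrite ltr0n cardfs_gt0.
(* If [O] is empty then [c] is 0, since division by 0 gives 0. *)
pose O := orbit_fset act x; pose c : R := #|` A|%:R / #|` O|%:R.
have c0 : 0 <= c by rewrite divr_ge0.
have c2 : c <= 2^-1.
  have [zO|nzO] := eqVneq O fset0.
    by rewrite /c zO cardfs0 invr0 mulr0 invr_ge0.
  have /fset0Pn[z zO] := nzO; have [g gz] := orbit_fset_sub zO.
  have OG : invariant_fset act O by move=> h y; rewrite /O orbit_fset_act.
  have xO : x \in O by rewrite -(orbit_fset_act act1 actM g) gz.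
  have := AO O OG xO; rewrite /c -(ler_nat R) natrM => AO2.
  have nO0 : 0 < #|` O|%:R :> R.
    by rewrite ltr0n cardfs_gt0; apply/fset0Pn; exists x.
  by rewrite ler_pdivrMr // -ler_pdivrMl ?invr_gt0 // invrK.
pose f y : R := (y \in A)%:R - c * (y \in O)%:R.
have key : eps ^+ 2 * (#|` A|%:R / 4) <= 2 * (d * #|` A|%:R).
  apply: (gap Y act act1 actM f (2 * #|` A|%:R + 2 * #|` O|%:R)).
  - move=> B; apply: (@le_trans _ _
      (\sum_(y <- B) (2 * (y \in A)%:R + 2 * (y \in O)%:R))).
      apply: ler_sum => y _; rewrite /f.
      by case: (y \in A); case: (y \in O) => /=; nra.
    by rewrite big_split /= -!mulr_sumr lerD // ler_wpM2l // sum_mem_fset_le.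
  - move=> s sG; rewrite sumrB -mulr_sumr !sum_mem_fset.
    have [xs|xs] := boolP (x \in s).
      have [gO Os] := sub_invariant_fset sG xs.
      have nO0 : #|` O|%:R != 0 :> R.
        rewrite pnatr_eq0 cardfs_eq0; apply/fset0Pn; exists (act 1%g x).
        exact: gO.
      rewrite (fsetIidPr _); last first.
        by apply/fsubsetP => y /Ax[g <-]; apply: sG.
      rewrite (fsetIidPr _); last exact/fsubsetP.
      by rewrite /c divfK // subrr.
    have disj (B : {fset Y}) : (forall y, y \in B -> exists g, act g x = y) ->
        #|` s `&` B|%fset = 0%N.
      move=> Bx; apply/eqP; rewrite cardfs_eq0 -fsubset0; apply/fsubsetP => y.
      rewrite inE => /andP[ys /Bx[g gy]]; move/negP : xs; case.
      by rewrite -(actK act1 actM g x) gy; exact: sG.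
    by rewrite !disj // ?mulr0 ?subrr // => y; exact: orbit_fset_sub.
  - by rewrite divr_gt0.
  - exists A; rewrite -sum1_size natr_sum mulr_suml /= big_seq [leRHS]big_seq.
    apply: ler_sum => y yA; rewrite /f yA.
    by case: (y \in O) => /=; nra.
  move=> q B qQ.
  have qI : injective (act q) := can_inj (actK act1 actM q).
  pose qA := [fset act q y | y in A]%fset.
  have qAE y : (act q^-1%g y \in A) = (y \in qA).
    apply/idP/imfsetP => [yA|[z /= zA ->]]; last by rewrite (actK act1 actM).
    by exists (act q^-1%g y); rewrite ?(actVK act1 actM).
  (* [A] and [qA] have the same size, so as much leaves [A] as enters it. *)
  have card_qA : #|` A `\` qA|%fset = #|` qA `\` A|%fset.
    by rewrite !cardfsD fsetIC (card_imfset _ _ qI).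
  apply: (@le_trans _ _ (\sum_(y <- B)
      ((y \in qA `\` A)%fset%:R + (y \in A `\` qA)%fset%:R))).
    apply: ler_sum => y _; rewrite /f orbit_fset_act // qAE !inE.
    by case: (y \in qA); case: (y \in A) => /=; nra.
  rewrite big_split /=.
  apply: (le_trans (lerD (sum_mem_fset_le _ _ _) (sum_mem_fset_le _ _ _))).
  by rewrite card_qA -mulr2n -[leLHS]mulr_natl ler_wpM2l // Ad.
by rewrite -(ler_pM2r nA0); lra.
Qed.
(** * Small word balls from subexponential growth *)

Lemma card_le_counting (R : realType) (T : choiceType) (A : {fset T})
    (S : set T) :
  [set` A] `<=` S -> (#|` A|%:R%:E <= (counting S : \bar R))%E.
Proof.
move=> AS; rewrite /counting; case: ifPn => [/asboolP finS|_]; last exact: leey.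
rewrite lee_fin ler_nat fsubset_leq_card //; apply/fsubsetP => y yA.
by rewrite in_fset_set // inE; exact: AS.
Qed.

(** The sublinear bound on the logarithms is used at the radius [C * n], with
    slope [ln a / C]. *)
Lemma subexponential_card_le (R : realType) (X : metricType R) (C : nat)
    (a : R) :
  uniform_subexponential_growth X -> (0 < C)%N -> 1 < a ->
  exists2 n : nat, (0 < n)%N & forall x (A : {fset X}),
    (forall y, y \in A -> mdist x y <= C%:R * n%:R) -> #|` A|%:R <= a ^+ n.
Proof.
move=> hX C0 a1.
have a0 : 0 < a by exact: lt_trans a1.
pose eta := ln a / C%:R.
have eta0 : 0 < eta by rewrite divr_gt0 ?ln_gt0 // ltr0n.
have : nbhs (0%E : \bar R) [set y | (y < eta%:E)%E].
  apply: open_nbhs_nbhs; split; first exact: open_ereal_lt_ereal.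
  by rewrite /= lte_fin.
move=> /hX[N _ Nlt]; exists N.+1 => // x A Ax.
rewrite leNgt; apply/negP => aA.
pose m := (C * N.+1)%N.
have m0 : 0 < m%:R :> R by rewrite ltr0n muln_gt0 C0.
have Nm : (N <= m)%N by rewrite /m (leq_trans (leqnSn N)) // leq_pmull.
move: (Nlt m Nm); apply/negP; rewrite -leNgt.
have A0 : 0 < #|` A|%:R :> R by apply: lt_trans aA; rewrite exprn_gt0.
set S := ereal_sup _.
have AS : ((#|` A|%:R : R)%:E <= S)%E.
  apply: le_trans (ereal_sup_ubound _); last by exists x.
  by apply: card_le_counting => y /= /Ax; rewrite /cball /= /m natrM.
apply: (@le_trans _ _ (m%:R^-1%:E * lne (#|` A|%:R)%:E)%E).
  rewrite lne_EFin // -EFinM lee_fin mulrC ler_pdivlMr //.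
  rewrite /eta /m natrM mulrA divfK ?pnatr_eq0 -?lt0n //.
  by rewrite mulr_natr -lnXn // ler_ln ?posrE ?exprn_gt0 // ltW.
rewrite lee_pmul2l ?lte_fin ?invr_gt0 //.
rewrite lee_lne // in_itv /= leey andbT ?lee_fin //.
by apply: le_trans AS; rewrite lee_fin.
Qed.

Section Foelner.
Variables (R : realType) (X : metricType R) (G : groupType) (act : G -> X -> X).
Hypothesis act1 : forall y, act 1%g y = y.
Hypothesis actM : forall g h y, act (g * h)%g y = act g (act h y).
Variables (Q : seq G) (C : nat).
Hypothesis C_gt0 : (0 < C)%N.
Hypothesis QC : forall q x, q \in Q -> mdist x (act q x) <= C%:R.

Fixpoint word_ball (n : nat) (x : X) : {fset X} :=
  if n is m.+1 then
    (word_ball m x `|` [fset act q y | q in Q, y in word_ball m x])%fset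
  else [fset x]%fset.

Lemma word_ball_act n x y q :
  q \in Q -> y \in word_ball n x -> act q y \in word_ball n.+1 x.
Proof.
move=> qQ yB; rewrite inE; apply/orP; right.
by apply/imfset2P; exists q => //; exists y.
Qed.

Lemma word_ball_ind n x (P : nat -> X -> Prop) : P 0%N x ->
  (forall m y, P m y -> P m.+1 y) ->
  (forall m y q, q \in Q -> P m y -> P m.+1 (act q y)) ->
  forall y, y \in word_ball n x -> P n y.
Proof.
move=> P0 PS PQ; elim: n => [|n IH] y /=; first by rewrite inE => /eqP ->.
rewrite inE => /orP[/IH/PS //|/imfset2P[q /= qQ [z /= /IH Pz ->]]].
exact: PQ.
Qed.

Lemma word_ball_sub m n x :
  (m <= n)%N -> (word_ball m x `<=` word_ball n x)%fset.
Proof.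
move=> /subnK <-; elim: (n - m)%N => [|k IH] //.
by rewrite addSn /=; apply: fsubset_trans IH (fsubsetUl _ _).
Qed.

Lemma word_ball_center n x : x \in word_ball n x.
Proof. by apply: (fsubsetP (word_ball_sub x (leq0n n))); rewrite inE. Qed.

Lemma word_ball_orbit n x y : y \in word_ball n x -> exists g, act g x = y.
Proof.
apply: (@word_ball_ind n x (fun _ y => exists g, act g x = y)) => //.
  by exists 1%g.
by move=> m {}y q _ [g <-]; exists (q * g)%g.
Qed.

Lemma word_ball_dist n x y : y \in word_ball n x -> mdist x y <= C%:R * n%:R.
Proof.
apply: (@word_ball_ind n x (fun n y => mdist x y <= C%:R * n%:R)) => //.
- by rewrite mdistxx mulr0.
- by move=> m {}y /le_trans; apply; rewrite ler_wpM2l // ler_nat.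
- move=> m {}y q qQ xy; apply: (le_trans (metric_triangle _ y _)).
  by rewrite -natr1 mulrDr mulr1 lerD // QC.
Qed.

(** If every ball of radius less than [n] grew by more than the factor [1 + d],
    the ball of radius [n] would have more than [(1 + d) ^ n] points. *)
Lemma bounded_foelner (d : R) : uniform_subexponential_growth X -> 0 < d ->
  exists M : nat, forall x, exists A : {fset X},
    [/\ A != fset0, forall y, y \in A -> exists g, act g x = y,
        (#|` A| <= M)%N
      & forall q, q \in Q ->
        #|` [fset act q y | y in A] `\` A|%fset%:R <= d * #|` A|%:R].
Proof.
move=> hX d0.
have [|n n0 nX] := subexponential_card_le hX C_gt0 (_ : 1 < 1 + d).
  by rewrite ltrDl.
exists (Num.truncn ((1 + d) ^+ n)) => x.
have le_n (m : nat) : (m <= n)%N -> #|` word_ball m x|%:R <= (1 + d) ^+ n :> R.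
  move=> mn; apply: nX => y /(fsubsetP (word_ball_sub x mn)).
  exact: word_ball_dist.
have [m mn slow] : exists2 m, (m < n)%N &
    #|` word_ball m.+1 x|%:R <= (1 + d) * #|` word_ball m x|%:R :> R.
  apply: contrapT => fast.
  have fastP m : (m < n)%N ->
      (1 + d) * #|` word_ball m x|%:R < #|` word_ball m.+1 x|%:R :> R.
    by move=> mn; rewrite ltNge; apply/negP => slow; apply: fast; exists m.
  have grow m : (m < n)%N -> (1 + d) ^+ m.+1 < #|` word_ball m.+1 x|%:R :> R.
    elim: m => [|m IH] mn; apply: le_lt_trans (fastP _ mn).
      by rewrite expr1 /= cardfs1 mulr1.
    by rewrite exprS ler_wpM2l ?addr_ge0 ?(ltW d0) // ltW // IH // ltnW.
  have := grow n.-1; rewrite prednK // => /(_ (leqnn _)).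
  by rewrite ltNge le_n.
exists (word_ball m x); split.
- by apply/fset0Pn; exists x; exact: word_ball_center.
- by move=> y; exact: word_ball_orbit.
- by rewrite truncn_ge_nat ?le_n ?(ltnW mn) // exprn_ge0 // addr_ge0 // ltW.
move=> q qQ.
apply: (@le_trans _ _ (#|` word_ball m.+1 x `\` word_ball m x|%fset%:R)).
  rewrite ler_nat fsubset_leq_card // fsetSD //.
  apply/fsubsetP => _ /imfsetP[y /= yB ->].
  exact: word_ball_act.
have sub := word_ball_sub x (leqnSn m).
rewrite cardfsDS // natrB ?fsubset_leq_card // lerBlDr.
by rewrite -[X in _ + X]mul1r -mulrDl addrC.
Qed.

End Foelner.
(** * Bounded orbits *)

(** The submonoid generated by [Q]. Inverses are left out because the induction
    over words reads the action of [Q] only. *)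
Inductive generated (G : groupType) (Q : seq G) : G -> Prop :=
| generated_one : generated Q 1%g
| generated_mul q h : q \in Q -> generated Q h -> generated Q (q * h)%g.

Section BoundedOrbits.
Variables (G : groupType) (X : choiceType) (act : G -> X -> X).
Hypothesis act1 : forall y, act 1%g y = y.
Hypothesis actM : forall g h y, act (g * h)%g y = act g (act h y).
Hypothesis act_faithful : forall g h, (forall x, act g x = act h x) -> g = h.
Variables (Q : seq G) (N : nat) (O : X -> {fset X}).
Hypothesis OG : forall x, invariant_fset act (O x).
Hypothesis xO : forall x, x \in O x.
Hypothesis ON : forall x, (#|` O x| <= N)%N.

Let pos x y : 'I_N.+1 := inord (index y (O x)).

Lemma orbit_posK x y : y \in O x -> nth x (O x) (pos x y) = y.
Proof.
move=> yO; rewrite inordK ?nth_index //.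
by rewrite ltnS (leq_trans (index_size _ _)) // ON.
Qed.

(* The Schreier graph of the orbit of [x], with edges labelled by [Q] and root
   [x]; its vertices are numbered by their positions in [O x], so that only
   finitely many graphs occur. *)
Let schreier x : 'I_N.+1 * {ffun 'I_N.+1 * 'I_(size Q) -> 'I_N.+1} :=
  (pos x x, [ffun p : 'I_N.+1 * 'I_(size Q) =>
               pos x (act (nth 1%g Q p.2) (nth x (O x) p.1))]).

(** A word in [Q] leads from the root to an endpoint that can be read off the
    graph. *)
Lemma pos_schreier h : generated Q h -> forall x y, schreier x = schreier y ->
  pos x (act h x) = pos y (act h y).
Proof.
elim=> [x y [xy _]|q k qQ _ IH x y xy]; first by rewrite !act1.
pose i := Ordinal (etrans (index_mem q Q) qQ).
have [_ /ffunP/(_ (pos x (act k x), i))] := xy.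
rewrite !ffunE /= nth_index // orbit_posK; last exact: OG.
by rewrite (IH x y) // orbit_posK ?actM //; exact: OG.
Qed.

(** An element [h] is recovered from the finite set of pairs formed by the
    rooted graph of [x] and the position of [h x], as [x] varies. *)
Lemma finite_generated : finite_set (generated Q).
Proof.
pose sig h := [set p | `[< exists x, p = (schreier x, pos x (act h x)) >]]%SET.
have sigI : {in (generated Q : set G) &, injective sig}.
  move=> h k /set_mem Hh /set_mem Hk hk; apply: act_faithful => x.
  have : (schreier x, pos x (act h x)) \in sig k.
    by rewrite -hk inE; apply/asboolP; exists x.
  rewrite inE => /asboolP[y [xy xE1 xE2]].
  have xyE : schreier x = schreier y by congr (_, _).
  rewrite -(@orbit_posK x (act h x)); last exact: OG.
  by rewrite xE2 -(pos_schreier Hk xyE) orbit_posK //; exact: OG.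
by rewrite -(eq_finite_set (inj_card_eq sigI)); exact: finite_finset.
Qed.

End BoundedOrbits.

(** If the orbits are bounded, the submonoid generated by [Q] is finite, and it
    is carried into itself by left multiplication by [Q]. For the action of [G]
    on itself, which has no nonempty finite invariant set, this contradicts
    expansion. *)
Lemma property_T_unbounded_orbits (R : realType) (G : groupType) :
    property_T R G -> infinite_set [set: G] ->
  forall (X : choiceType) (act : G -> X -> X),
    (forall y, act 1%g y = y) ->
    (forall g h y, act (g * h)%g y = act g (act h y)) ->
    (forall g h, (forall x, act g x = act h x) -> g = h) ->
  forall N : nat, exists x, forall O : {fset X},
    invariant_fset act O -> x \in O -> (N < #|` O|)%N.
Proof.
move=> /property_T_expansion[Q [eps [eps0 expand]]] infG.
move=> X act act1 actM faith N.
apply: contrapT => bounded.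
have /choice[orb orbP] : forall x, exists O : {fset X},
    [/\ invariant_fset act O, x \in O & (#|` O| <= N)%N].
  move=> x; apply: contrapT => unbounded; apply: bounded; exists x => O OG xO.
  by rewrite ltnNge; apply/negP => ON; apply: unbounded; exists O.
have finH : finite_set (generated Q).
  apply: (@finite_generated _ _ _ act1 actM faith Q N orb) => x;
    by case: (orbP x).
have memH g : (g \in fset_set (generated Q)) = `[< generated Q g >].
  by rewrite in_fset_set // asboolE.
suff : eps ^+ 2 <= 8 * 0 by rewrite mulr0 leNgt exprn_gt0.
apply: (expand G (fun g h => (g * h)%g) (@mul1g G)
  (fun g h k => esym (mulgA g h k)) 1%g (fset_set (generated Q))).
- apply/fset0Pn; exists 1%g; rewrite memH; apply/asboolP.
  exact: generated_one.
- by move=> g _; exists g; rewrite mulg1.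
- move=> S SG oneS; case: infG; apply: (@sub_finite_set _ _ [set` S]).
    by move=> g _ /=; rewrite -[g]mulg1; exact: SG.
  exact: finite_fset.
- move=> q qQ; rewrite mul0r lern0 cardfs_eq0 -fsubset0.
  apply/fsubsetP => g; rewrite inE => /andP[gH /imfsetP[h /= hH gE]].
  move: gH; rewrite gE memH => /asboolP[]; move: hH; rewrite memH => /asboolP.
  exact: generated_mul.
Qed.

(** * Property (T) subgroups of the wobbling group *)

Lemma bounded_displacement (R : realType) (X : metricType R) (G : groupType)
    (f : G -> wobbling X) (Q : seq G) :
  exists2 C : nat, (0 < C)%N & forall q x, q \in Q -> mdist x (f q x) <= C%:R.
Proof.
elim: Q => [|q Q [C C0 QC]]; first by exists 1%N.
have [c qc] := wobbling_bounded (f q).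
exists (maxn C (Num.truncn c).+1); first by rewrite leq_max C0.
move=> g x; rewrite inE => /orP[/eqP ->|/QC /le_trans]; last first.
  by apply; rewrite ler_nat leq_maxl.
apply: (@le_trans _ _ c); first by apply: qc; exists x.
by rewrite ltW // (lt_le_trans (truncnS_gt c)) // ler_nat leq_maxr.
Qed.

Theorem theorem4p1 (R : realType) (X : metricType R)
    (hX : uniform_subexponential_growth X) :
  ~ exists G : groupType,
      [/\ infinite_set [set: G], countable [set: G], property_T R G
        & exists f : {multiplicative G -> wobbling X}, injective f].
Proof.
move=> [G [infG _ TG [f fI]]].
pose act g x := f g x.
have f1 : f 1%g = 1%g by apply: (mulgI (f 1%g)); rewrite -gmulfM !mulg1.
have act1 y : act 1%g y = y by rewrite /act f1.
have actM g h y : act (g * h)%g y = act g (act h y) by rewrite /act gmulfM.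
have faith g h : (forall x, act g x = act h x) -> g = h.
  by move=> gh; apply: fI; exact: wobbling_inj.
have [Q [eps [eps0 expand]]] := property_T_expansion TG.
have [C C0 QC] := bounded_displacement f Q.
(* Half of the value [eps ^+ 2 / 8] at which expansion becomes possible. *)
have d0 : 0 < eps ^+ 2 / 16 by rewrite divr_gt0 // exprn_gt0.
have [M foelner] := bounded_foelner act1 actM C0 QC hX d0.
have [x xM] := property_T_unbounded_orbits TG infG act1 actM faith (2 * M)%N.
have [A [A0 Ax AM Aq]] := foelner x.
have := expand X act act1 actM x A _ A0 Ax _ Aq.
have AO (O : {fset X}) :
    invariant_fset act O -> x \in O -> (2 * #|` A| <= #|` O|)%N.
  by move=> OG xO; rewrite (leq_trans _ (ltnW (xM O OG xO))) // leq_mul2l.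
move=> /(_ AO); have : 0 < eps ^+ 2 by rewrite exprn_gt0.
by move: (eps ^+ 2) => e; lra.
Qed.
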